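(* Let $A$ be a $DP$ algebra over $R$, and let $d:A\to\Omega^{CA}_{A/R}$ be the universal (commutative-algebra) derivation into the module of Kähler differentials. Then there is a unique left $U(A)$-module structure on $\Omega^{CA}_{A/R}$ extending its $A_+$-module structure such that $d$ is a $DP$ derivation. Moreover, with this structure $d$ is the universal $DP$ derivation: for every left $U(A)$-module $M$ and every $DP$ derivation $s:A\to M$ there is a unique $U(A)$-module homomorphism $f:\Omega^{CA}_{A/R}\to M$ with $s=f\circ d$. In other words, $\Omega^{DP}_{A/R}\cong\Omega^{CA}_{A/R}$.
   Context: Fix a commutative unital ring $R$; unadorned $\otimes$ means $\otimes_R$. An ''algebra'' means a commutative, not necessarily unital, $R$-algebra. A $DP$ algebra is an algebra $A$ with maps $\gamma_n:A\to A$ ($n\ge1$) such that for all $a,b\in A$, $r\in R$, $m,n\ge1$: $\gamma_1(a)=a$; $\gamma_n(a+b)=\gamma_n(a)+\sum_{i+j=n,\,i,j\ge1}\gamma_i(a)\gamma_j(b)+\gamma_n(b)$; $\gamma_n(ab)=a^n\gamma_n(b)$; $\gamma_n(rb)=r^n\gamma_n(b)$; $\gamma_m(a)\gamma_n(a)=\frac{(m+n)!}{m!\,n!}\gamma_{m+n}(a)$; $\gamma_m(\gamma_n(a))=\frac{(mn)!}{m!(n!)^m}\gamma_{mn}(a)$. $A_+=A\oplus R$ is the unital algebra with $(a,r)(b,s)=(ab+sa+rb,rs)$. $\Omega^{CA}_{A/R}=(A_+\otimes A)/(a\otimes b-1\otimes ab+b\otimes a : a,b\in A)$ as an $A_+$-module,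 with $d(a)=[1\otimes a]$; it is the universal $R$-linear derivation of $A$ into $A_+$-modules. A left $U(A)$-module is an $A_+$-module $M$ with pairwise commuting additive operators $\phi_p$ ($p$ prime) satisfying $p\phi_p=0$, $\phi_p(rx)=r^p\phi_p(x)$ for $r\in R$, and $\phi_p(ax)=0$ for $a\in A$, $x\in M$ (equivalently a module over the ring $U(A)=A_+\otimes_R U(0)$, where $U(0)$ is generated by $R$ and commuting symbols $\phi_p$ with $p\phi_p=0$, $\phi_pr=r^p\phi_p$, and $(1\otimes\phi_p)(a\otimes 1)=0$ for $a\in A$); set $\phi_1=\mathrm{id}$, $\phi_{p^e}=\phi_p^e$, $\phi_n=0$ for $n>1$ not a prime power. For such $M$, $A\oplus M$ is a $DP$ algebra with $(a,x)(b,y)=(ab,ay+bx)$ and $\gamma_n(a,x)=\big(\gamma_n(a),\ \phi_n x+\sum_{i+j=n,\,i,j\ge1}\gamma_i(a)\phi_j(x)\big)$. A $DP$ derivation $s:A\to M$ is an $R$-linear map such that $a\mapsto(a,s(a))$ is a $DP$ algebra homomorphism $A\to A\oplus M$; equivalently $s(ab)=as(b)+bs(a)$ and $s(\gamma_n a)=\phi_n(s a)+\sum_{i+j=n,\,i,j\ge1}\gamma_i(a)\phi_j(s a)$. $\Omega^{DP}_{A/R}$ denotes the target of the universal $DP$ derivation of $A$. *)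

(* Defs.v *)
From HB Require Import structures.
From mathcomp Require Import all_boot all_algebra.
Set Implicit Arguments. Unset Strict Implicit. Unset Printing Implicit Defensive.
Import GRing.Theory.
Local Open Scope ring_scope.

Section DPDefs.
Variable R : comPzRingType.

Definition Rlin (V W : lmodType R) (f : V -> W) : Prop :=
  forall (r : R) (x y : V), f (r *: x + y) = r *: f x + f y.

Definition is_calg (A : lmodType R) (mul : A -> A -> A) : Prop :=
  [/\ forall a b c, mul a (mul b c) = mul (mul a b) c,
      forall a b, mul a b = mul b a,
      forall a b c, mul (a + b) c = mul a c + mul b c
    & forall (r : R) a b, mul (r *: a) b = r *: mul a b].

(* a^n for n >= 1 in a non-unital algebra: a^1 = a, a^(n+1) = a * a^n *)
Definition apow (A : lmodType R) (mul : A -> A -> A) (a : A) (n : nat) : A :=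
  iter n.-1 (mul a) a.

Definition is_DP (A : lmodType R) (mul : A -> A -> A) (gam : nat -> A -> A)
  : Prop :=
  (forall a, gam 1%N a = a) /\
  [/\ forall n a b, (0 < n)%N ->
        gam n (a + b) = gam n a
          + \sum_(1 <= i < n) mul (gam i a) (gam (n - i)%N b) + gam n b,
      forall n a b, (0 < n)%N -> gam n (mul a b) = mul (apow mul a n) (gam n b),
      forall n (r : R) b, (0 < n)%N -> gam n (r *: b) = r ^+ n *: gam n b,
      forall m n a, (0 < m)%N -> (0 < n)%N ->
        mul (gam m a) (gam n a) = gam (m + n)%N a *+ 'C(m + n, m)
    & forall m n a, (0 < m)%N -> (0 < n)%N ->
        gam m (gam n a) =
          gam (m * n)%N a *+ ((m * n)`! %/ (m`! * (n`! ^ m)))%N].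

(* An A_+-module: an R-module M with an action of A that is R-bilinear and
   associative, (a,r).x := a.x + r x. *)
Definition is_Amod (A : lmodType R) (mul : A -> A -> A)
  (M : lmodType R) (act : A -> M -> M) : Prop :=
  [/\ forall a (r : R) x y, act a (r *: x + y) = r *: act a x + act a y,
      forall (r : R) a b x, act (r *: a + b) x = r *: act a x + act b x
    & forall a b x, act (mul a b) x = act a (act b x)].

(* phi_n built from phi_p (p prime): phi_1 = id, phi_{p^e} = phi_p^e,
   phi_n = 0 if n > 1 is not a prime power. *)
Definition phin (M : lmodType R) (phi : nat -> M -> M) (n : nat) : M -> M :=
  if n == 1%N then id
  else let p := pdiv n in
       if (1 < n)%N && (n == p ^ logn p n)%N then iter (logn p n) (phi p)
       else fun _ => 0.

(* A left U(A)-module: an A_+-module with operators phi_p, p prime. *)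
Definition is_Umod (A : lmodType R) (mul : A -> A -> A)
  (M : lmodType R) (act : A -> M -> M) (phi : nat -> M -> M) : Prop :=
  is_Amod mul act /\
  [/\ forall p x y, prime p -> phi p (x + y) = phi p x + phi p y,
      forall p q x, prime p -> prime q -> phi p (phi q x) = phi q (phi p x),
      forall p x, prime p -> phi p x *+ p = 0,
      forall p (r : R) x, prime p -> phi p (r *: x) = r ^+ p *: phi p x
    & forall p a x, prime p -> phi p (act a x) = 0].

Definition is_deriv (A : lmodType R) (mul : A -> A -> A)
  (M : lmodType R) (act : A -> M -> M) (s : A -> M) : Prop :=
  Rlin s /\ forall a b, s (mul a b) = act a (s b) + act b (s a).

Definition is_DPderiv (A : lmodType R) (mul : A -> A -> A)
  (gam : nat -> A -> A) (M : lmodType R) (act : A -> M -> M)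
  (phi : nat -> M -> M) (s : A -> M) : Prop :=
  is_deriv mul act s /\
  forall n a, (0 < n)%N ->
    s (gam n a) = phin phi n (s a)
      + \sum_(1 <= i < n) act (gam i a) (phin phi (n - i)%N (s a)).

Definition is_Ahom (A : lmodType R) (M N : lmodType R)
  (actM : A -> M -> M) (actN : A -> N -> N) (f : M -> N) : Prop :=
  Rlin f /\ forall a x, f (actM a x) = actN a (f x).

Definition is_Uhom (A : lmodType R) (M N : lmodType R)
  (actM : A -> M -> M) (phiM : nat -> M -> M)
  (actN : A -> N -> N) (phiN : nat -> N -> N) (f : M -> N) : Prop :=
  is_Ahom actM actN f /\ forall p x, prime p -> f (phiM p x) = phiN p (f x).

(* (Om, actO, d) is the universal R-linear derivation of A into
   A_+-modules, i.e. Om = Omega^{CA}_{A/R} with d the universal derivation. *)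
Definition is_universal_deriv (A : lmodType R) (mul : A -> A -> A)
  (Om : lmodType R) (actO : A -> Om -> Om) (d : A -> Om) : Prop :=
  [/\ is_Amod mul actO, is_deriv mul actO d &
      forall (N : lmodType R) (actN : A -> N -> N) (D : A -> N),
        is_Amod mul actN -> is_deriv mul actN D ->
        exists f : Om -> N, [/\ is_Ahom actO actN f, forall a, D a = f (d a) &
          forall g : Om -> N, is_Ahom actO actN g -> (forall a, D a = g (d a)) ->
            forall x, g x = f x]].

End DPDefs.

(* Main.v *)
Require Import Defs.
From HB Require Import structures.
From mathcomp Require Import all_boot all_algebra.
From mathcomp Require Import zify.
From Stdlib Require Import IndefiniteDescription.
Set Implicit Arguments. Unset Strict Implicit. Unset Printing Implicit Defensive.
Import GRing.Theory.
Local Open Scope ring_scope.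

(** Let [G_a(t) = 1 + sum_(n >= 1) gam_n(a) t^n] and let [log_deriv n a] be the
    coefficient of [t^n] in [dG_a / G_a].  A derivation [s] is a DP derivation
    for operators [phi] exactly when [phi_n (s a)] equals [log_deriv n a], so
    only [phi_p (d a) := log_deriv p a] is possible.  The identities
    [G_(a+b) = G_a G_b], [G_(ra)(t) = G_a(rt)] and [G_(ab)(t) = G_b(at)] make
    [log_deriv p] additive, Frobenius semilinear and zero on products, while
    [G_a(t) G_a(u) = G_a(t+u)] gives ['C(n, m) log_deriv n a = 0] for
    [0 < m < n].  Hence [log_deriv n] vanishes unless [n] is a prime power, has
    [p]-torsion values for [n = p^e], and, working modulo torsion prime to [p],
    [log_deriv p (gam_(p^e) a) = log_deriv p^(e+1) a].  Finally, Frobenius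
    semilinear maps that kill [A Omega] and have [p]-torsion values are
    [A_+]-linear maps into the [p]-torsion module with scalars twisted by
    Frobenius and zero [A]-action, so the universal property of [Omega]
    constructs [phi_p] and proves both uniqueness statements. *)

(** * Binomial and iterated divided power coefficients modulo a prime *)

(** Since [j * 'C(M, j) = M * 'C(M.-1, j.-1)], if [p] did not divide ['C(M, j)] then [p ^ e] would
    divide [j]. *)
Lemma prime_dvd_bin_multiple (p e M j : nat) : prime p ->
  (p ^ e %| M -> 0 < j < p ^ e -> p %| 'C(M, j))%N.
Proof.
move=> pp dM /andP[j0 je]; case: (posnP M) => [->|M0].
  by rewrite bin0n eqn0Ngt j0 dvdn0.
case: j j0 je => // j _ je; rewrite -(prednK M0) in dM *.
apply: contraLR je; rewrite -leqNgt -prime_coprime // => co.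
apply: dvdn_leq => //; have := dvdn_mulr 'C(M.-1, j) dM.
by rewrite mul_bin_diag Gauss_dvdl // coprimeXl.
Qed.

(** In the Vandermonde expansion every term except the one of index 0 contains some ['C(M, i)] with
    [0 < i < p ^ e], which [p] divides. *)
Lemma bin_add_multiple_mod (p e M r : nat) : prime p ->
  (p ^ e %| M -> r < p ^ e -> 'C(M + r, r) = 1 %[mod p])%N.
Proof.
move=> pp dM re; rewrite -binomial.Vandermonde big_ord_recl /= bin0 subn0 binn.
rewrite -modnDmr.
suff /eqP -> : (p %| \sum_(i < r) 'C(M, bump 0 i) * 'C(r, r - bump 0 i))%N.
  by rewrite addn0.
apply: dvdn_sum => i _; apply: dvdn_mulr; apply: (@prime_dvd_bin_multiple p e) => //.
by rewrite /bump /= add1n /= (leq_ltn_trans _ re).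
Qed.

(** Absorption splits off the factor [k.+1]; for [n = p ^ e] the remaining binomial is 1 modulo
    [p]. *)
Lemma bin_multiple_diag (k n : nat) : (0 < n)%N ->
  'C(k.+1 * n, n)%N = (k.+1 * 'C(k * n + n.-1, n.-1))%N.
Proof.
case: n => // n _; apply/eqP; rewrite -(eqn_pmul2l (ltn0Sn n)) /=.
have -> : (k.+1 * n.+1 = (k * n.+1 + n).+1)%N by lia.
rewrite -mul_bin_diag /=; apply/eqP; lia.
Qed.

Lemma coprime_bin_ppart (p e k : nat) : prime p ->
  (~~ (p %| k) -> coprime p 'C(k * p ^ e, p ^ e))%N.
Proof.
move=> pp pk; have q0 : (0 < p ^ e)%N by rewrite expn_gt0 prime_gt0.
case: k pk => [|k pk]; first by rewrite dvdn0.
rewrite bin_multiple_diag // coprimeMr !prime_coprime // pk /= /dvdn.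
rewrite (@bin_add_multiple_mod p e) ?dvdn_mull ?ltn_predL //.
by rewrite modn_small ?prime_gt1.
Qed.

(* The coefficient in gam_m (gam_n a) = iter_gam_coef m n * gam_(mn) a. *)
Definition iter_gam_coef (m n : nat) : nat := ((m * n)`! %/ (m`! * n`! ^ m))%N.

Lemma fact_mulS (m n : nat) : (0 < n)%N ->
  ((m.+1 * n)`! = m.+1 * 'C(m * n + n.-1, n.-1) * n`! * (m * n)`!)%N.
Proof.
move=> n0; rewrite -bin_multiple_diag // -(@bin_fact (m.+1 * n)%N n) ?leq_pmull //.
by rewrite mulnA mulSn addKn.
Qed.

(** The truncated division in [iter_gam_coef] is exact, by induction on [m]. *)
Lemma iter_gam_coef_fact (m n : nat) : (0 < n)%N ->
  (iter_gam_coef m n * (m`! * n`! ^ m) = (m * n)`!)%N.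
Proof.
move=> n0; apply: divnK; elim: m => [|m IH]; first by rewrite !mul0n expn0.
rewrite fact_mulS // factS expnS.
have -> : (m.+1 * m`! * (n`! * n`! ^ m) = m.+1 * n`! * (m`! * n`! ^ m))%N by lia.
by apply: dvdn_mul => //; rewrite mulnAC dvdn_mulr.
Qed.

Lemma iter_gam_coefS (m n : nat) : (0 < n)%N ->
  (iter_gam_coef m.+1 n = iter_gam_coef m n * 'C(m * n + n.-1, n.-1))%N.
Proof.
move=> n0; have pos : (0 < m.+1`! * n`! ^ m.+1)%N.
  by rewrite muln_gt0 fact_gt0 expn_gt0 fact_gt0.
apply/eqP; rewrite -(eqn_pmul2r pos) iter_gam_coef_fact // fact_mulS //.
by rewrite -(iter_gam_coef_fact m) // factS expnS; apply/eqP; lia.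
Qed.

(** The coefficient is a product of binomials ['C(i * p ^ e + (p ^ e).-1, (p ^ e).-1)], each equal
    to 1 modulo [p]. *)
Lemma iter_gam_coef_mod (p e m : nat) : prime p ->
  iter_gam_coef m (p ^ e) = 1 %[mod p].
Proof.
move=> pp; have q0 : (0 < p ^ e)%N by rewrite expn_gt0 prime_gt0.
elim: m => [|m IH]; first by rewrite /iter_gam_coef mul0n expn0.
rewrite iter_gam_coefS // -modnMm IH (@bin_add_multiple_mod p e) ?dvdn_mull ?ltn_predL //.
by rewrite modnMm.
Qed.

(** * Torsion prime to [p] *)

Lemma mulrn_coprime_eq0 (V : zmodType) (x : V) (m n : nat) :
  coprime m n -> x *+ m = 0 -> x *+ n = 0 -> x = 0.
Proof.
move=> co xm xn; case: (posnP m) => [m0|m0].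
  by move: co xn; rewrite m0 /coprime gcd0n => /eqP ->.
have [km kn E _] := egcdnP n m0.
move: E; rewrite (eqP co) => /(congr1 (fun k => x *+ k)).
by rewrite mulrnDr [(km * m)%N]mulnC [(kn * n)%N]mulnC !mulrnA xm xn !mul0rn add0r.
Qed.

Lemma mulrn_eq_mod (V : zmodType) (x : V) (p m n : nat) :
  x *+ p = 0 -> m = n %[mod p] -> x *+ m = x *+ n.
Proof.
move=> xp E; rewrite (divn_eq m p) (divn_eq n p) -E !mulrnDr.
by rewrite ![(_ %/ p * p)%N]mulnC !mulrnA xp !mul0rn.
Qed.

(** For [p] prime, these are the elements that vanish in the localization of [V] at [p]; working
    modulo them replaces localizing. *)
Definition prime_to_torsion (V : zmodType) (p : nat) (x : V) : Prop :=
  exists2 N, coprime p N & x *+ N = 0.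

Lemma prime_to_torsionD (V : zmodType) p (x y : V) :
  prime_to_torsion p x -> prime_to_torsion p y -> prime_to_torsion p (x + y).
Proof.
move=> [m cm xm] [n cn yn]; exists (m * n)%N; first by rewrite coprimeMr cm.
by rewrite mulrnDl mulrnA xm mul0rn mulnC mulrnA yn mul0rn add0r.
Qed.

Lemma prime_to_torsion0 (V : zmodType) p : prime_to_torsion p (0 : V).
Proof. by exists 1%N; rewrite ?coprimen1 ?mul0rn. Qed.

Lemma prime_to_torsionN (V : zmodType) p (x : V) :
  prime_to_torsion p x -> prime_to_torsion p (- x).
Proof. by case=> m cm xm; exists m; rewrite // mulNrn xm oppr0. Qed.

Lemma prime_to_torsionMn (V : zmodType) p (x : V) n :
  prime_to_torsion p x -> prime_to_torsion p (x *+ n).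
Proof. by case=> m cm xm; exists m; rewrite // mulrnAC xm mul0rn. Qed.

Lemma prime_to_torsion_sum (V : zmodType) p m n (F : nat -> V) :
  (forall i, (m <= i < n)%N -> prime_to_torsion p (F i)) ->
  prime_to_torsion p (\sum_(m <= i < n) F i).
Proof.
move=> H; rewrite big_seq; apply: big_ind.
- exact: prime_to_torsion0.
- by move=> x y; apply: prime_to_torsionD.
by move=> i; rewrite mem_index_iota; apply: H.
Qed.

Lemma prime_to_torsion_eq0 (V : zmodType) p k (x : V) :
  prime_to_torsion p x -> x *+ p ^ k = 0 -> x = 0.
Proof.
by move=> [N cN xN] xp; apply: (mulrn_coprime_eq0 _ xp xN); rewrite coprimeXl.
Qed.

(** Local-global principle, removing one prime factor of [n] at a time: [x *+ (n %/ p)] is killed by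
    [p] and is torsion prime to [p], hence zero. *)
Lemma mulrn_prime_to_torsion_eq0 (V : zmodType) n (x : V) : (0 < n)%N ->
  x *+ n = 0 -> (forall p, prime p -> prime_to_torsion p x) -> x = 0.
Proof.
elim/ltn_ind: n => n IH n0 xn H.
case: (ltnP 1 n) => [n1|n1]; last first.
  by move: xn; have -> : n = 1%N by apply/eqP; rewrite eqn_leq n1.
have pp := pdiv_prime n1; set p := pdiv n in pp.
have En : (n = n %/ p * p)%N by rewrite divnK ?pdiv_dvd.
apply: (IH (n %/ p)%N) => //.
- by rewrite ltn_Pdiv ?prime_gt1.
- by rewrite divn_gt0 ?prime_gt0 // dvdn_leq ?pdiv_dvd.
apply: (@prime_to_torsion_eq0 _ p 1); first exact/prime_to_torsionMn/H.
by rewrite expn1 -mulrnA -En.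
Qed.

(** Both sides run over [i + j <= n]; this serves to reassociate products of power series. *)
Lemma exchange_big_triangle (V : zmodType) n (F : nat -> nat -> V) :
  \sum_(0 <= i < n.+1) \sum_(0 <= j < (n - i).+1) F i j =
  \sum_(0 <= j < n.+1) \sum_(0 <= i < (n - j).+1) F i j.
Proof.
have E G i : (i < n.+1)%N -> \sum_(0 <= j < (n - i).+1) G i j =
    \sum_(0 <= j < n.+1 | (i + j <= n)%N) G i j :> V.
  move=> ile; rewrite (big_nat_widen 0 _ n.+1) ?ltnS ?leq_subr //=.
  by apply: eq_bigl => j; rewrite ltnS leq_subRL.
transitivity (\sum_(0 <= i < n.+1) \sum_(0 <= j < n.+1 | (i + j <= n)%N) F i j).
  by apply: eq_big_nat => i /= /E ->.
rewrite (exchange_big_dep_nat xpredT) //=; apply: eq_big_nat => j /= lj.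
by rewrite (E (fun j i => F i j)) //; apply: eq_bigl => i; rewrite addnC.
Qed.

(** * The [p]-torsion submodule with Frobenius-twisted scalars *)

(* Multiplication by [r ^+ p] is additive in [r] on [p]-torsion only, hence the
   restriction to that subgroup. *)
Record frobenius_torsion (R : comPzRingType) (V : lmodType R) (p : nat)
  (p_prime : prime p) := FrobeniusTorsion {
    frobenius_val : V;
    _ : [pred x : V | x *+ p == 0] frobenius_val }.

Section FrobeniusTorsion.
Variables (R : comPzRingType) (V : lmodType R) (p : nat) (p_prime : prime p).
Local Notation W := (frobenius_torsion V p_prime).
Local Notation torsion := [pred x : V | x *+ p == 0].

HB.instance Definition _ := [isSub of W for @frobenius_val R V p p_prime].
HB.instance Definition _ := [Choice of W by <:].

Fact torsion_zmod_closed : zmod_closed torsion.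
Proof.
split; first by rewrite inE mul0rn.
by move=> x y; rewrite !inE mulrnBl => /eqP -> /eqP ->; rewrite subrr.
Qed.
HB.instance Definition _ := GRing.isZmodClosed.Build V torsion torsion_zmod_closed.
HB.instance Definition _ := [SubChoice_isSubZmodule of W by <:].

Lemma frobenius_valP (x : W) : val x *+ p = 0.
Proof. by apply/eqP; case: x. Qed.

Fact frobenius_scale_subproof (r : R) (x : W) : torsion (r ^+ p *: val x).
Proof. by rewrite /= scalerMnr frobenius_valP scaler0. Qed.

Definition frobenius_scale (r : R) (x : W) : W :=
  @FrobeniusTorsion R V p p_prime _ (frobenius_scale_subproof r x).

Fact frobenius_scalerA a b (x : W) :
  frobenius_scale a (frobenius_scale b x) = frobenius_scale (a * b) x.
Proof. by apply: val_inj; rewrite /= scalerA exprMn. Qed.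

Fact frobenius_scale1r : left_id 1 frobenius_scale.
Proof. by move=> x; apply: val_inj; rewrite /= expr1n scale1r. Qed.

Fact frobenius_scalerDr : right_distributive frobenius_scale +%R.
Proof. by move=> a x y; apply: val_inj; rewrite /= scalerDr. Qed.

(** The middle terms of [(a + b) ^+ p] have coefficients divisible by [p], which annihilate [x]. *)
Fact frobenius_scalerDl (x : W) :
  {morph frobenius_scale^~ x : a b / a + b}.
Proof.
move=> a b; apply: val_inj => /=; case: x => x /= /eqP xp.
rewrite exprDn scaler_suml.
case: p p_prime xp => // q q_prime xp.
rewrite big_ord_recl big_ord_recr /= subn0 expr0 mulr1 bin0 subnn expr0 mul1r binn !mulr1n.
rewrite big1 ?add0r // => i _.
rewrite -scalerMnl scalerMnr.
have /dvdnP[k ->] : (q.+1 %| 'C(q.+1, lift ord0 (widen_ord (leqnSn q) i)))%N.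
  by rewrite prime_dvd_bin //= /bump /= add1n ltnS ltn_ord.
by rewrite mulnC mulrnA xp mul0rn scaler0.
Qed.

HB.instance Definition _ := GRing.Zmodule_isLmodule.Build R W frobenius_scalerA
  frobenius_scale1r frobenius_scalerDr frobenius_scalerDl.

End FrobeniusTorsion.

(** * The logarithmic derivative of the divided power series *)

Section LogDerivative.
Variables (R : comPzRingType) (A : lmodType R) (mul : A -> A -> A).
Variables (gam : nat -> A -> A) (M : lmodType R) (act : A -> M -> M) (s : A -> M).

(* Action of gam_n(a) with the convention gam_0(a) = 1. *)
Definition gam_act (n : nat) (a : A) (x : M) : M :=
  if n is 0%N then x else act (gam n a) x.

(** Coefficient of [t^n] in [dG_a]; the constant term 1 of [G_a] has derivative 0. *)
Definition dgam (n : nat) (a : A) : M := if n is 0%N then 0 else s (gam n a).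

(** Course-of-values recursion solving [dG_a = G_a * L_a] for the coefficients of [L_a]: the table
    built in [n] steps is meaningful at indices at most [n]. *)
Fixpoint log_deriv_upto (n : nat) (a : A) : nat -> M :=
  if n is m.+1 then fun k =>
    if (k <= m)%N then log_deriv_upto m a k
    else dgam k a - \sum_(0 <= i < k) gam_act (k - i) a (log_deriv_upto m a i)
  else fun _ => 0.

Definition log_deriv (n : nat) (a : A) : M := log_deriv_upto n a n.

Lemma log_deriv_uptoE n a k : (k <= n)%N -> log_deriv_upto n a k = log_deriv k a.
Proof.
elim: n => [|n IH]; first by rewrite leqn0 => /eqP ->.
rewrite leq_eqVlt => /orP[/eqP -> //|]; rewrite ltnS /= => kn.
by rewrite kn IH.
Qed.

Lemma log_deriv0 a : log_deriv 0 a = 0. Proof. by []. Qed.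

Lemma dgamE n a :
  dgam n a = \sum_(0 <= k < n.+1) gam_act (n - k) a (log_deriv k a).
Proof.
case: n => [|n]; first by rewrite big_nat1.
rewrite big_nat_recr //= subnn {2}/log_deriv /= ltnn.
rewrite [X in _ = X + _](_ : _ = \sum_(0 <= i < n.+1)
  gam_act (n.+1 - i) a (log_deriv_upto n a i)) ?subrKC //.
by apply: eq_big_nat => i /=; rewrite ltnS => /log_deriv_uptoE ->.
Qed.

(** As [G_a] has constant term 1, the system [dG_a = G_a * u] is triangular and determines [u].
    Identities for [log_deriv] below are obtained by checking this system. *)
Lemma log_deriv_unique (u : nat -> M) a :
  (forall n, dgam n a = \sum_(0 <= k < n.+1) gam_act (n - k) a (u k)) ->
  forall n, u n = log_deriv n a.
Proof.
move=> H; elim/ltn_ind => n IH.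
have := H n; rewrite dgamE !big_nat_recr //= subnn /=.
rewrite [X in X + _ = _](_ : _ = \sum_(0 <= i < n) gam_act (n - i) a (u i)).
  by move/addrI.
by apply: eq_big_nat => i /andP[_ /IH ->].
Qed.

Hypothesis calg : is_calg mul.
Hypothesis DP : is_DP mul gam.
Hypothesis Amod : is_Amod mul act.
Hypothesis der : is_deriv mul act s.

Let mulC a b : mul a b = mul b a. Proof. by case: calg. Qed.
Let actM a b x : act (mul a b) x = act a (act b x). Proof. by case: Amod. Qed.
Let actC a b x : act a (act b x) = act b (act a x).
Proof. by rewrite -!actM mulC. Qed.
Let act_lin a r x y : act a (r *: x + y) = r *: act a x + act a y.
Proof. by case: Amod. Qed.
Let actr0 a : act a 0 = 0.
Proof.
have := act_lin a 1 0 0; rewrite !scale1r addr0 => /eqP.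
by rewrite -subr_eq0 opprD addrA subrr sub0r oppr_eq0 => /eqP.
Qed.
Let actrD a x y : act a (x + y) = act a x + act a y.
Proof. by have := act_lin a 1 x y; rewrite !scale1r. Qed.
Let actrZ a r x : act a (r *: x) = r *: act a x.
Proof. by have := act_lin a r x 0; rewrite !addr0 actr0 addr0. Qed.
Let actrMn a x n : act a (x *+ n) = act a x *+ n.
Proof. by elim: n => [|n IH]; rewrite ?mulr0n ?actr0 // !mulrS actrD IH. Qed.
Let actr_sum I r (F : I -> M) a :
  act a (\sum_(i <- r) F i) = \sum_(i <- r) act a (F i).
Proof. exact: (big_morph (act a) (actrD a) (actr0 a)). Qed.
Let act_linl r a b x : act (r *: a + b) x = r *: act a x + act b x.
Proof. by case: Amod. Qed.
Let act0r x : act 0 x = 0.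
Proof.
have := act_linl 1 0 0 x; rewrite !scale1r addr0 => /eqP.
by rewrite -subr_eq0 opprD addrA subrr sub0r oppr_eq0 => /eqP.
Qed.
Let actDr a b x : act (a + b) x = act a x + act b x.
Proof. by have := act_linl 1 a b x; rewrite !scale1r. Qed.
Let actZr r a x : act (r *: a) x = r *: act a x.
Proof. by have := act_linl r a 0 x; rewrite !addr0 act0r addr0. Qed.
Let actMnr a x n : act (a *+ n) x = act a x *+ n.
Proof. by elim: n => [|n IH]; rewrite ?mulr0n ?act0r // !mulrS actDr IH. Qed.
Let act_suml I r (F : I -> A) x :
  act (\sum_(i <- r) F i) x = \sum_(i <- r) act (F i) x.
Proof. exact: (big_morph (act^~ x) (fun a b => actDr a b x) (act0r x)). Qed.

Let s_lin r a b : s (r *: a + b) = r *: s a + s b. Proof. by case: der. Qed.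
Let sM a b : s (mul a b) = act a (s b) + act b (s a). Proof. by case: der. Qed.
Let s0 : s 0 = 0.
Proof.
have := s_lin 1 0 0; rewrite !scale1r addr0 => /eqP.
by rewrite -subr_eq0 opprD addrA subrr sub0r oppr_eq0 => /eqP.
Qed.
Let sD a b : s (a + b) = s a + s b.
Proof. by have := s_lin 1 a b; rewrite !scale1r. Qed.
Let sZ r a : s (r *: a) = r *: s a.
Proof. by have := s_lin r a 0; rewrite !addr0 s0 addr0. Qed.
Let sMn a n : s (a *+ n) = s a *+ n.
Proof. by elim: n => [|n IH]; rewrite ?mulr0n ?s0 // !mulrS sD IH. Qed.
Let s_sum I r (F : I -> A) : s (\sum_(i <- r) F i) = \sum_(i <- r) s (F i).
Proof. exact: (big_morph s sD s0). Qed.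

Let gam1 a : gam 1 a = a. Proof. by case: DP. Qed.
Let gamD n a b : (0 < n)%N -> gam n (a + b) = gam n a
          + \sum_(1 <= i < n) mul (gam i a) (gam (n - i)%N b) + gam n b.
Proof. by case: DP => _ [] H _ _ _ _; apply: H. Qed.
Let gamM n a b : (0 < n)%N -> gam n (mul a b) = mul (apow mul a n) (gam n b).
Proof. by case: DP => _ [] _ H _ _ _; apply: H. Qed.
Let gamZ n r b : (0 < n)%N -> gam n (r *: b) = r ^+ n *: gam n b.
Proof. by case: DP => _ [] _ _ H _ _; apply: H. Qed.
Let gam_mul m n a : (0 < m)%N -> (0 < n)%N ->
        mul (gam m a) (gam n a) = gam (m + n)%N a *+ 'C(m + n, m).
Proof. by case: DP => _ [] _ _ _ H _; apply: H. Qed.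
Let gam_comp m n a : (0 < m)%N -> (0 < n)%N ->
        gam m (gam n a) = gam (m * n)%N a *+ iter_gam_coef m n.
Proof. by case: DP => _ [] _ _ _ _ H; apply: H. Qed.

(** * Sums and scalar multiples: [G_(a+b) = G_a G_b] and [G_(ra)(t) = G_a(rt)] *)

Lemma gam_actD n a x y : gam_act n a (x + y) = gam_act n a x + gam_act n a y.
Proof. by case: n => [|n] //=; exact: actrD. Qed.

Lemma gam_act0 n a : gam_act n a 0 = 0.
Proof. by case: n => [|n] //=; exact: actr0. Qed.

Lemma gam_actMn n a x k : gam_act n a (x *+ k) = gam_act n a x *+ k.
Proof. by case: n => [|n] //=; exact: actrMn. Qed.

Lemma gam_act_sum I r (F : I -> M) n a :
  gam_act n a (\sum_(i <- r) F i) = \sum_(i <- r) gam_act n a (F i).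
Proof. by case: n => [|n] //=; exact: actr_sum. Qed.

Lemma gam_act_add n a b x : gam_act n (a + b) x =
  \sum_(0 <= i < n.+1) gam_act i a (gam_act (n - i) b x).
Proof.
case: n => [|n]; first by rewrite big_nat1.
rewrite big_nat_recr // big_nat_recl //= subnn subn0 gamD // !actDr.
rewrite [RHS]addrC addrA addrAC act_suml big_add1 /=; congr (_ + _ + _).
apply: eq_big_nat => i /andP[_ i_n]; by rewrite actM (subSn i_n).
Qed.

Lemma gam_actZ n r a x : gam_act n (r *: a) x = r ^+ n *: gam_act n a x.
Proof. by case: n => [|n] /=; rewrite ?expr0 ?scale1r // gamZ // actZr. Qed.

Lemma gam_act_mul m n a x :
  gam_act m a (gam_act n a x) = gam_act (m + n) a x *+ 'C(m + n, m).
Proof.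
case: m n => [|m] [|n]; rewrite ?bin0 ?addn0 ?binn //.
by rewrite /gam_act addSn -actM gam_mul // actMnr.
Qed.

Lemma dgam_add n a b : dgam n (a + b) = \sum_(0 <= i < n.+1)
  (gam_act i a (dgam (n - i) b) + gam_act (n - i) b (dgam i a)).
Proof.
case: n => [|n]; first by rewrite big_nat1 /= addr0.
rewrite big_nat_recr // big_nat_recl //= subnn subn0 gamD // !sD /=.
rewrite !actr0 addr0 add0r [RHS]addrC addrA addrAC s_sum big_add1 /=; congr (_ + _ + _).
by apply: eq_big_nat => i /andP[_ i_n]; rewrite sM (subSn i_n).
Qed.

Lemma dgam_pos n a : (0 < n)%N -> dgam n a = s (gam n a).
Proof. by case: n. Qed.

Lemma gam_act_prime_to_torsion p n a x :
  prime_to_torsion p x -> prime_to_torsion p (gam_act n a x).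
Proof. by case=> N cN xN; exists N; rewrite // -gam_actMn xN gam_act0. Qed.

Lemma log_deriv_convl n a b :
  \sum_(0 <= k < n.+1) gam_act (n - k) (a + b) (log_deriv k b) =
  \sum_(0 <= i < n.+1) gam_act i a (dgam (n - i) b).
Proof.
under eq_bigr => k _ do rewrite gam_act_add.
rewrite -exchange_big_triangle; apply: eq_bigr => i _.
rewrite dgamE gam_act_sum; apply: eq_bigr => k _.
by rewrite subnAC.
Qed.

(** [G_(a+b) (L_a + L_b) = G_b dG_a + G_a dG_b = d(G_a G_b)]. *)
Lemma log_derivD n a b : log_deriv n (a + b) = log_deriv n a + log_deriv n b.
Proof.
apply/esym; move: n; apply: (@log_deriv_unique (fun n => _)) => n.
under [RHS]eq_bigr => k _ do rewrite gam_actD.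
rewrite dgam_add !big_split /= log_deriv_convl addrC; congr (_ + _).
rewrite addrC log_deriv_convl big_nat_rev /=; apply: eq_big_nat => i /= i_n.
by rewrite add0n subSS subKn.
Qed.

Lemma log_derivZ n r a : log_deriv n (r *: a) = r ^+ n *: log_deriv n a.
Proof.
apply/esym; move: n; apply: (@log_deriv_unique (fun n => _)) => n.
have -> : dgam n (r *: a) = r ^+ n *: dgam n a.
  by case: n => [|n] /=; rewrite ?scaler0 // gamZ // sZ.
rewrite dgamE scaler_sumr; apply: eq_big_nat => k /= k_n.
rewrite gam_actZ [gam_act _ _ (_ *: _)](_ : _ = r ^+ k *: gam_act (n - k) a (log_deriv k a)).
  by rewrite scalerA -exprD subnK.
by case: (n - k)%N => [|m] //=; exact: actrZ.
Qed.

Lemma log_deriv1 a : log_deriv 1 a = s a.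
Proof.
by have := dgamE 1 a; rewrite big_nat_recr // big_nat1 log_deriv0 gam_act0 /= add0r gam1.
Qed.

(** * Products: [G_(ab)(t) = G_b(at)] *)

Lemma apowS a n : apow mul a n.+2 = mul a (apow mul a n.+1).
Proof. by []. Qed.

Lemma act_apow a n x : act (apow mul a n.+1) x = iter n.+1 (act a) x.
Proof. by elim: n => [|n IH] //; rewrite apowS actM IH. Qed.

Lemma deriv_apow a n : s (apow mul a n.+1) = iter n (act a) (s a) *+ n.+1.
Proof.
elim: n => [|n IH] //; rewrite apowS sM IH actrMn act_apow -iterS.
by rewrite -mulrSr.
Qed.

Lemma apow_fact a n : apow mul a n.+1 = gam n.+1 a *+ n.+1`!.
Proof.
elim: n => [|n IH]; first by rewrite gam1.
have mulMn x y k : mul x (y *+ k) = mul x y *+ k.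
  have mulD u v w : mul u (v + w) = mul u v + mul u w.
    by rewrite mulC; case: calg => _ _ -> _; rewrite ![mul _ u]mulC.
  have mul0 u : mul u 0 = 0 by apply: (@addrI _ (mul u 0)); rewrite -mulD !addr0.
  by elim: k => [|k IHk]; rewrite ?mulr0n // !mulrS mulD IHk.
by rewrite apowS IH mulMn -{1}[a]gam1 gam_mul // bin1 -mulrnA factS.
Qed.

Lemma iter_actD a n x y :
  iter n (act a) (x + y) = iter n (act a) x + iter n (act a) y.
Proof. by elim: n => [|n IH] //=; rewrite IH ?actrD // actC. Qed.

Lemma iter_actMn a n x k : iter n (act a) (x *+ k) = iter n (act a) x *+ k.
Proof. by elim: n => [|n IH] //=; rewrite IH actrMn. Qed.

Lemma iter_actC a b n x : iter n (act a) (act b x) = act b (iter n (act a) x).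
Proof. by elim: n => [|n IH] //=; rewrite IH ?actrD // actC. Qed.

Lemma gam_act_prod n a b x :
  gam_act n (mul a b) x = iter n (act a) (gam_act n b x).
Proof. by case: n => [|n] //=; rewrite gamM // actM act_apow. Qed.

(** Differentiating [G_b(at)] and using [G_b' = b G_b] gives [L_(ab)(t) = L_b(at) + t b s(a)]; the
    last term only affects degree 1. *)
Lemma log_deriv_prod n a b : (1 < n)%N ->
  log_deriv n (mul a b) = iter n (act a) (log_deriv n b).
Proof.
pose u n := iter n (act a) (log_deriv n b) + (if n == 1%N then act b (s a) else 0).
move=> n1; suff <- : u n = log_deriv n (mul a b).
  by rewrite /u; case: eqP n1 => [-> //|_ _]; rewrite addr0.
apply: log_deriv_unique => {n n1} -[|n]; first by rewrite big_nat1 /u /= addr0.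
under eq_bigr => k _ do rewrite gam_actD gam_act_prod.
rewrite big_split /=.
rewrite gamM // sM act_apow deriv_apow actrMn; congr (_ + _).
  rewrite -/(dgam n.+1 b) dgamE.
  rewrite (big_morph _ (iter_actD a n.+1) (_ : _ = 0)); last first.
    by elim: (n.+1) => [|m IH] //=; rewrite IH actr0.
  apply: eq_big_nat => k /= k_n.
  have -> : gam_act (n.+1 - k) b (iter k (act a) (log_deriv k b)) =
      iter k (act a) (gam_act (n.+1 - k) b (log_deriv k b)).
    by case: (n.+1 - k)%N => [|m] //=; rewrite iter_actC.
  by rewrite -iterD subnK.
rewrite (bigD1_seq 1%N) ?iota_uniq ?mem_index_iota //=.
rewrite big1 => [|i /negPf ->]; last by rewrite gam_act0.
rewrite addr0 subn1 /= gam_act_prod.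
(* This is [b G_b = G_b'], coefficient by coefficient. *)
have -> : gam_act n b (act b (s a)) = gam_act n.+1 b (s a) *+ n.+1.
  rewrite -{2}[b]gam1 -/(gam_act 1 b _) gam_act_mul addn1.
  by rewrite binSn.
by rewrite iter_actMn iter_actC.
Qed.

(** * Torsion of the coefficients of the logarithmic derivative *)

(** Coefficient of [u^m t^(n-m)] in [G_a(u) dG_a(t) = G_a(t+u) L_a(t)]. The terms with [k > n - m]
    are harmless, since then [n - k < m]. *)
Lemma gam_act_dgam m n a : (m <= n)%N -> gam_act m a (dgam (n - m) a) =
  \sum_(0 <= k < n.+1) gam_act (n - k) a (log_deriv k a) *+ 'C(n - k, m).
Proof.
move=> m_n; rewrite dgamE gam_act_sum [RHS](big_cat_nat (n := (n - m).+1)) //=; last first.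
  by rewrite ltnS leq_subr.
rewrite [X in _ = _ + X]big_nat [X in _ = _ + X]big1 ?addr0 => [|k /andP[k1 k2]]; last first.
  by rewrite bin_small ?mulr0n //; lia.
apply: eq_big_nat => k /= k_n.
by rewrite gam_act_mul subnAC subnKC //; lia.
Qed.

(** Differentiating [G_a(t) G_a(u) = G_a(t+u)] gives [L_a(t+u) = L_a(t) + L_a(u)]; compare
    coefficients of [t^(n-m) u^m]. Instead of dividing by [G_a(t+u)], the proof cancels the lower
    terms by strong induction on [n]. *)
Lemma bin_log_deriv n m a : (0 < m < n)%N -> log_deriv n a *+ 'C(n, m) = 0.
Proof.
elim/ltn_ind: n m => n IH m /andP[m0 mn].
have E : dgam n a *+ 'C(n, m) =
    gam_act m a (dgam (n - m) a) + gam_act (n - m) a (dgam (n - (n - m)) a).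
  rewrite (subKn (ltnW mn)).
  case: m m0 mn => // m _ mn; have := subnK (ltnW mn).
  have : (0 < n - m.+1)%N by rewrite subn_gt0.
  case: (n - m.+1)%N => // k _ <-; rewrite [(k.+1 + _)%N]addnC /=.
  by rewrite -sM gam_mul // sMn addSn.
have := E; rewrite !gam_act_dgam ?leq_subr ?(ltnW mn) //.
rewrite dgamE -sumrMnl !big_nat_recr //= subnn !bin0n.
rewrite eqn0Ngt m0 subn_eq0 leqNgt mn /= mulr0n addr0 addr0.
rewrite -big_split /= => /eqP.
rewrite -subr_eq0 addrAC -sumrB big_nat big1 ?add0r => [/eqP //|k kn].
rewrite -mulrnDr -!gam_actMn.
(* Expand ['C(n, m)] by Vandermonde along [n = k + (n - k)]: the terms with [0 < j < k] die by
   induction, so only [j = 0] and [j = k] remain. *)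
suff -> : log_deriv k a *+ 'C(n, m) = log_deriv k a *+ ('C(n - k, m) + 'C(n - k, n - m)).
  by rewrite subrr.
case: k kn => [|k /andP[_ kn]]; first by rewrite log_deriv0 !mul0rn.
rewrite -{1}(subnKC (ltnW kn)) -binomial.Vandermonde -sumrMnr big_ord_recl bin0 mul1n subn0 mulrnDr.
congr (_ + _).
have z (j : 'I_m) : j != k :> nat ->
    log_deriv k.+1 a *+ ('C(k.+1, lift ord0 j) * 'C(n - k.+1, m - lift ord0 j)) = 0.
  rewrite /= /bump add1n => jk; rewrite mulrnA; case: (ltngtP j k) jk => // jk _.
    by rewrite IH ?mul0rn.
  by rewrite bin_small // mulr0n mul0rn.
(* With [k] now shifted by one, the term of index [k.+1] occurs only if [k.+1 <= m]; otherwise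
   ['C(n - k.+1, n - m)] is zero as well. *)
case: (ltnP k m) => km.
  rewrite (bigD1 (Ordinal km)) //= big1 => [|j jk]; last by apply: z; exact: jk.
  rewrite addr0 /bump add1n binn mul1n -bin_sub; last by lia.
  by congr (_ *+ 'C(_, _)); lia.
rewrite big1 => [|j _]; last by apply: z; rewrite neq_ltn (leq_trans (ltn_ord j)).
by rewrite bin_small ?mulr0n //; lia.
Qed.

Lemma log_deriv_mulrn n a : (1 < n)%N -> log_deriv n a *+ n = 0.
Proof. by move=> n1; rewrite -[X in _ *+ X]bin1 bin_log_deriv. Qed.

(** With [q] the [p]-part of [k], the integer ['C(k, q)] is prime to [p] and, as [0 < q < k], kills
    the coefficient. *)
Lemma log_deriv_prime_to_torsion p k a : prime p -> (0 < k)%N ->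
  k != (p ^ logn p k)%N -> prime_to_torsion p (log_deriv k a).
Proof.
move=> pp k0 kp; have [m pm Ek] := pfactor_coprime pp k0.
have q0 : (0 < p ^ logn p k)%N by rewrite expn_gt0 prime_gt0.
exists 'C(k, p ^ logn p k); last first.
  apply: bin_log_deriv; rewrite q0 ltn_neqAle eq_sym kp /=.
  by rewrite dvdn_leq // pfactor_dvdnn.
by rewrite {1}Ek coprime_bin_ppart // -prime_coprime.
Qed.

Lemma log_deriv_prime_power_torsion p e a : prime p -> (0 < e)%N ->
  log_deriv (p ^ e) a *+ p = 0.
Proof.
case: e => // e pp _; have q0 : (0 < p ^ e)%N by rewrite expn_gt0 prime_gt0.
have p1 := prime_gt1 pp.
apply: (@prime_to_torsion_eq0 _ p e.+1); last first.
  rewrite mulrnAC log_deriv_mulrn ?mul0rn //.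
  by rewrite (leq_trans p1) // expnS leq_pmulr.
(* The witness is ['C(p ^ e.+1, p ^ e)] divided by [p]. *)
exists 'C(p.-1 * p ^ e + (p ^ e).-1, (p ^ e).-1).
  rewrite prime_coprime // /dvdn (@bin_add_multiple_mod p e) ?dvdn_mull ?ltn_predL //.
  by rewrite modn_small.
rewrite -mulrnA -[X in (X * _)%N](prednK (ltnW p1)) -bin_multiple_diag //.
rewrite (prednK (ltnW p1)) -expnS bin_log_deriv // q0 expnS.
by rewrite -[X in (X < _)%N]mul1n ltn_pmul2r.
Qed.

Lemma log_deriv_eq0 n a : (1 < n)%N ->
  (forall p, prime p -> n != (p ^ logn p n)%N) -> log_deriv n a = 0.
Proof.
move=> n1 H; apply: (@mulrn_prime_to_torsion_eq0 _ n); first exact: ltnW.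
  exact: log_deriv_mulrn.
by move=> p pp; apply: log_deriv_prime_to_torsion; rewrite ?H // ltnW.
Qed.

Lemma log_deriv_prime_prod p a b : prime p -> log_deriv p (mul a b) = 0.
Proof.
move=> pp; rewrite log_deriv_prod ?prime_gt1 //.
have E := log_deriv_mulrn b (prime_gt1 pp).
case: p pp E => // p pp E.
rewrite -act_apow apow_fact actMnr -actrMn factS mulrnA E mul0rn.
exact: actr0.
Qed.

(** With [n = p ^ e] and [y = gam n a], compare two expansions of [s (gam p y)]: through [y], and
    through [gam (p * n) a *+ c]. Modulo torsion prime to [p] the first is [log_deriv p y] plus the
    action of [gam p.-1 y] on [s y]. The difference is also killed by [p], hence zero. *)
Lemma log_deriv_prime_gam p e a : prime p ->
  log_deriv p (gam (p ^ e) a) = log_deriv (p ^ e.+1) a.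
Proof.
move=> pp; set n := (p ^ e)%N; set y := gam n a.
have p1 := prime_gt1 pp.
have n0 : (0 < n)%N by rewrite expn_gt0 prime_gt0.
have c1 m : iter_gam_coef m n = 1 %[mod p] by apply: iter_gam_coef_mod.
have tors_top : log_deriv (p ^ e.+1) a *+ p = 0 by apply: log_deriv_prime_power_torsion.
rewrite expnS -/n in tors_top *.
have cS : iter_gam_coef p n = (iter_gam_coef p.-1 n * 'C(p.-1 * n + n.-1, n.-1))%N.
  by rewrite -iter_gam_coefS // prednK // ltnW.
set c := iter_gam_coef p n in cS; set c' := iter_gam_coef p.-1 n in cS.
suff T : prime_to_torsion p (log_deriv p y - log_deriv (p * n) a *+ c).
  apply/eqP; rewrite -subr_eq0; apply/eqP.
  rewrite -[X in _ - X]mulr1n -(mulrn_eq_mod tors_top (c1 p)).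
  apply: (prime_to_torsion_eq0 (k := 1) T).
  rewrite expn1 mulrnBl log_deriv_mulrn // mulrnAC tors_top mul0rn subrr //.
have pn0 : (0 < p * n)%N by rewrite muln_gt0 n0 ltnW.
have q0 : (0 < p.-1)%N by rewrite -subn1 subn_gt0.
have pnE : (p * n - p.-1 * n = n)%N by rewrite -mulnBl -subn1 subKn ?mul1n // ltnW.
have E1 : dgam p y = dgam (p * n) a *+ c.
  by rewrite !dgam_pos ?(ltnW p1) // /y gam_comp ?(ltnW p1) // sMn.
have E2 : gam_act p.-1 y (s y) = \sum_(0 <= k < (p * n).+1)
    gam_act (p * n - k) a (log_deriv k a) *+ ('C(p * n - k, p.-1 * n) * c').
  have -> : gam_act p.-1 y (s y) =
      gam_act (p.-1 * n) a (dgam (p * n - p.-1 * n) a) *+ c'.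
    rewrite pnE dgam_pos // /gam_act.
    rewrite -(prednK q0) -(prednK (_ : 0 < p.-1.-1.+1 * n)%N) ?muln_gt0 //.
    by rewrite (prednK q0) prednK ?muln_gt0 ?q0 // gam_comp // actMnr.
  rewrite gam_act_dgam ?leq_mul2r ?leq_pred ?orbT // -sumrMnl.
  by apply: eq_bigr => k _; rewrite mulrnA.
have E3 : prime_to_torsion p (dgam p y - log_deriv p y - gam_act p.-1 y (s y)).
  rewrite dgamE big_nat_recr //= subnn addrK big_ltn ?(ltnW p1) // big_ltn //.
  rewrite log_deriv0 gam_act0 add0r log_deriv1 subn1 addrAC subrr add0r.
  (* No [j] with [1 < j < p] is a power of [p]. *)
  apply: prime_to_torsion_sum => j /andP[j1 jp].
  apply/gam_act_prime_to_torsion/log_deriv_prime_to_torsion => //; first exact: ltnW.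
  by rewrite lognE gtnNdvd ?(ltnW j1) // !andbF expn0 neq_ltn j1 orbT.
have -> : log_deriv p y - log_deriv (p * n) a *+ c =
    (dgam p y - gam_act p.-1 y (s y) - log_deriv (p * n) a *+ c)
    - (dgam p y - log_deriv p y - gam_act p.-1 y (s y)).
  by rewrite (addrAC _ (- log_deriv p y)) opprB [RHS]addrC addrA subrK.
apply: prime_to_torsionD; last exact: prime_to_torsionN.
rewrite E1 E2 dgamE -sumrMnl -sumrB big_nat_recr //= subnn bin0n.
rewrite eqn0Ngt muln_gt0 q0 n0 mul0n mulr0n subr0 addrK.
apply: prime_to_torsion_sum => k /andP[_ kpn].
rewrite -!gam_actMn.
case: (posnP k) => [->|k0].
  rewrite log_deriv0 !mul0rn subrr; exact: prime_to_torsion0.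
have [Ek|Nk] := eqVneq k (p ^ logn p k)%N; last first.
  apply: prime_to_torsionD; last apply: prime_to_torsionN;
    apply/gam_act_prime_to_torsion/prime_to_torsionMn;
    exact: log_deriv_prime_to_torsion.
suff -> : log_deriv k a *+ c =
    log_deriv k a *+ ('C(p * n - k, p.-1 * n) * c').
  rewrite subrr; exact: prime_to_torsion0.
have kn : (k <= n)%N.
  rewrite Ek leq_exp2l // -ltnS -(ltn_exp2l _ _ p1) -Ek expnS.
  exact: kpn.
have binE : 'C(p * n - k, p.-1 * n) = 'C(p.-1 * n + (n - k), n - k).
  rewrite addnBA // -[in RHS]mulSnr prednK ?(ltnW p1) //.
  by rewrite -bin_sub; [congr 'C(_, _)|]; lia.
(* For [k = 1] the coefficient is [s a], not known to be torsion, so the integers must agree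
   exactly, which is [cS]. For larger powers of [p] the coefficient is [p]-torsion and agreement
   modulo [p] suffices. *)
rewrite binE; case: (posnP (logn p k)) => [e0|e0].
  have -> : k = 1%N by rewrite Ek e0.
  by rewrite subn1 cS mulnC.
apply: (@mulrn_eq_mod _ _ p); first by rewrite Ek log_deriv_prime_power_torsion.
rewrite c1 -modnMm c1 (@bin_add_multiple_mod p e) ?dvdn_mull ?modnMm //.
by rewrite -/n; lia.
Qed.

(** * DP derivations in terms of the logarithmic derivative *)

Lemma sum_gam_act (u : nat -> M) n a : u 0%N = 0 -> (0 < n)%N ->
  \sum_(0 <= k < n.+1) gam_act (n - k) a (u k) =
  u n + \sum_(1 <= i < n) act (gam i a) (u (n - i)%N).
Proof.
move=> u0 n0; rewrite big_nat_recr //= subnn [LHS]addrC big_ltn // u0 gam_act0.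
rewrite add0r big_nat_rev /=; congr (_ + _); apply: eq_big_nat => i /andP[i1 i_n].
have -> : (n - (1 + n - i.+1) = i)%N by lia.
by have -> : (1 + n - i.+1 = n - i)%N; [lia | case: i i1 {i_n}].
Qed.

(** The DP condition is the coefficient form of [dG_a = G_a * u] with [u n = phin phi n (s a)],
    whose solution is unique. In degree 0 it holds because [phin phi 0] is the zero map. *)
Lemma DPderiv_log_deriv phi : is_DPderiv mul gam act phi s <->
  forall n a, (0 < n)%N -> phin phi n (s a) = log_deriv n a.
Proof.
split=> [[_ H] [//|n] a _|H].
  apply: (log_deriv_unique (u := fun k => phin phi k (s a))) => -[|m].
    by rewrite big_nat1.
  by rewrite sum_gam_act // -H.
split=> // n a n0; rewrite H // -dgam_pos // dgamE sum_gam_act //.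
congr (_ + _); apply: eq_big_nat => i /andP[_ i_n].
by rewrite H // subn_gt0.
Qed.

End LogDerivative.

(** * Frobenius semilinear maps out of the Kähler differentials *)

Definition is_frobenius_hom (R : comPzRingType) (A V W : lmodType R)
  (act : A -> V -> V) (p : nat) (f : V -> W) : Prop :=
  [/\ forall r x y, f (r *: x + y) = r ^+ p *: f x + f y,
      forall a x, f (act a x) = 0 & forall x, f x *+ p = 0].

Lemma frobenius_hom_universal (R : comPzRingType) (A : lmodType R)
  (mul : A -> A -> A) (Om : lmodType R) (actO : A -> Om -> Om) (d : A -> Om)
  (V : lmodType R) (p : nat) (D : A -> V) :
  is_universal_deriv mul actO d -> prime p ->
  (forall r a b, D (r *: a + b) = r ^+ p *: D a + D b) ->
  (forall a b, D (mul a b) = 0) -> (forall a, D a *+ p = 0) ->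
  exists f : Om -> V, [/\ is_frobenius_hom actO p f, forall a, f (d a) = D a &
    forall g, is_frobenius_hom actO p g -> (forall a, g (d a) = D a) -> f =1 g].
Proof.
move=> [_ _ univ] pp DL DM Dp.
pose W := frobenius_torsion V pp.
pose toW (x : V) (xp : x *+ p = 0) : W := @FrobeniusTorsion R V p pp x (introT eqP xp).
(* For the zero action the Leibniz rule says exactly that products go to 0. *)
pose act0 (_ : A) (_ : W) : W := 0.
have mod0 : is_Amod mul act0.
  by split=> *; rewrite /act0 ?scaler0 ?addr0.
have der0 : is_deriv mul act0 (fun a => toW (D a) (Dp a)).
  split=> [r a b|a b]; apply: val_inj; first exact: DL.
  by rewrite /= DM addr0.
have [f [[fL fA] fd funiq]] := univ W act0 _ mod0 der0.
exists (fun x => val (f x)); split.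
- split=> [r x y|a x|x]; [by rewrite fL | by rewrite fA | exact: frobenius_valP].
- by move=> a; rewrite -fd.
move=> g [gL gA gp] gd x.
rewrite -(funiq (fun x => toW (g x) (gp x))) //.
  split=> [r y z|a y]; apply: val_inj; first exact: gL.
  by rewrite /= gA.
by move=> a; apply: val_inj; rewrite /= gd.
Qed.

Lemma Umod_frobenius_hom (R : comPzRingType) (A : lmodType R)
  (mul : A -> A -> A) (M : lmodType R) (act : A -> M -> M)
  (phi : nat -> M -> M) (p : nat) :
  is_Umod mul act phi -> prime p -> is_frobenius_hom act p (phi p).
Proof.
move=> [_ [phiD _ phip phiZ phiA]] pp; split=> *; rewrite ?phiD ?phiZ //; auto.
Qed.

Lemma phin_prime (R : comPzRingType) (M : lmodType R) (phi : nat -> M -> M) p :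
  prime p -> phin phi p = phi p.
Proof.
move=> pp; rewrite /phin pdiv_id // logn_prime // eqxx expn1 eqxx prime_gt1 //.
by case: eqP pp => // ->.
Qed.

Lemma phin_prime_power (R : comPzRingType) (M : lmodType R)
  (phi : nat -> M -> M) p e :
  prime p -> phin phi (p ^ e) = iter e (phi p).
Proof.
case: e => [|e] pp; first by rewrite expn0.
have q1 : (1 < p ^ e.+1)%N by rewrite (ltn_exp2l 0) ?prime_gt1.
rewrite /phin pdiv_pfactor // pfactorK // eqxx q1 /=.
by case: eqP q1 => // ->.
Qed.

Lemma phin_not_prime_power (R : comPzRingType) (M : lmodType R)
  (phi : nat -> M -> M) n x :
  (1 < n)%N -> n != (pdiv n ^ logn (pdiv n) n)%N -> phin phi n x = 0.
Proof. by move=> n1 /negPf Hn; rewrite /phin Hn andbF; case: eqP n1 => // ->. Qed.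

Lemma log_deriv_frobenius_hom (R : comPzRingType) (A : lmodType R)
  (mul : A -> A -> A) (gam : nat -> A -> A)
  (Om : lmodType R) (actO : A -> Om -> Om) (d : A -> Om)
  (M : lmodType R) (actM : A -> M -> M) (s : A -> M) (p : nat) :
  is_calg mul -> is_DP mul gam -> is_universal_deriv mul actO d ->
  is_Amod mul actM -> is_deriv mul actM s -> prime p ->
  exists f : Om -> M, [/\ is_frobenius_hom actO p f,
    forall a, f (d a) = log_deriv gam actM s p a &
    forall g, is_frobenius_hom actO p g ->
      (forall a, g (d a) = log_deriv gam actM s p a) -> f =1 g].
Proof.
move=> calg DP univ Amod der pp; apply: (frobenius_hom_universal univ pp).
- by move=> r a b; rewrite (log_derivD DP Amod der) (log_derivZ DP Amod der).
- by move=> a b; rewrite (log_deriv_prime_prod calg DP Amod der).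
by move=> a; rewrite (log_deriv_mulrn DP Amod der) ?prime_gt1.
Qed.

(** Applying [f] to the system that defines the logarithmic derivative of [s] yields the one for
    [t]. *)
Lemma Ahom_log_deriv (R : comPzRingType) (A : lmodType R)
  (gam : nat -> A -> A) (M N : lmodType R) (actM : A -> M -> M)
  (actN : A -> N -> N) (s : A -> M) (t : A -> N) (f : M -> N) n a :
  is_Ahom actM actN f -> (forall b, t b = f (s b)) ->
  f (log_deriv gam actM s n a) = log_deriv gam actN t n a.
Proof.
move=> [fL fA] tE.
have fD x y : f (x + y) = f x + f y by have := fL 1 x y; rewrite !scale1r.
have f0 : f 0 = 0 by apply: (@addrI _ (f 0)); rewrite -fD !addr0.
move: n; apply: (log_deriv_unique (u := fun n => f _)) => n.
have -> : dgam gam t n a = f (dgam gam s n a) by case: n => [|n] /=.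
rewrite (dgamE _ actM) (big_morph f fD f0); apply: eq_bigr => k _.
by case: (n - k)%N => [|m] //=.
Qed.

Theorem mainTheorem5 (R : comPzRingType) (A : lmodType R)
  (mul : A -> A -> A) (gam : nat -> A -> A)
  (Om : lmodType R) (actO : A -> Om -> Om) (d : A -> Om) :
  is_calg mul -> is_DP mul gam -> is_universal_deriv mul actO d ->
  exists phiO : nat -> Om -> Om,
    [/\ is_Umod mul actO phiO,
        is_DPderiv mul gam actO phiO d,
        (forall phi' : nat -> Om -> Om,
            is_Umod mul actO phi' -> is_DPderiv mul gam actO phi' d ->
            forall p x, prime p -> phi' p x = phiO p x)
      & forall (M : lmodType R) (actM : A -> M -> M) (phiM : nat -> M -> M)
               (s : A -> M),
          is_Umod mul actM phiM -> is_DPderiv mul gam actM phiM s ->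
          exists f : Om -> M,
            [/\ is_Uhom actO phiO actM phiM f, forall a, s a = f (d a) &
              forall g : Om -> M, is_Uhom actO phiO actM phiM g ->
                (forall a, s a = g (d a)) -> forall x, g x = f x]].
Proof.
move=> calg DP univ; have [AmodO derO univO] := univ.
pose delta := log_deriv gam actO d.
have [phi phiP] : exists phi : nat -> Om -> Om, forall p, prime p ->
    [/\ is_frobenius_hom actO p (phi p), forall a, phi p (d a) = delta p a &
      forall g, is_frobenius_hom actO p g ->
        (forall a, g (d a) = delta p a) -> phi p =1 g].
  apply: (functional_choice (fun p f => prime p -> [/\ is_frobenius_hom actO p f,
    forall a, f (d a) = delta p a & forall g, is_frobenius_hom actO p g ->
        (forall a, g (d a) = delta p a) -> f =1 g])) => p.
  (* At a non-prime index the operator is irrelevant, and [id] fills the place. *)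
  have [pp|/negP np] := boolP (prime p); last by exists id.
  have [f fP] := log_deriv_frobenius_hom calg DP univ AmodO derO pp.
  by exists f.
have phiL p : prime p -> forall r x y,
    phi p (r *: x + y) = r ^+ p *: phi p x + phi p y.
  by case/phiP=> -[].
have phiA p : prime p -> forall a x, phi p (actO a x) = 0 by case/phiP=> -[].
have phip p : prime p -> forall x, phi p x *+ p = 0 by case/phiP=> -[].
have phid p : prime p -> forall a, phi p (d a) = delta p a by case/phiP.
have phiD p : prime p -> forall x y, phi p (x + y) = phi p x + phi p y.
  by move=> pp x y; have := phiL p pp 1 x y; rewrite expr1n !scale1r.
have phi0 p : prime p -> phi p 0 = 0.
  by move=> pp; apply: (@addrI _ (phi p 0)); rewrite -phiD // !addr0.
have phiMn p n x : prime p -> phi p (x *+ n) = phi p x *+ n.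
  move=> pp; elim: n => [|n IH]; first by rewrite !mulr0n phi0.
  by rewrite !mulrS phiD // IH.
have UmodO : is_Umod mul actO phi.
  split=> //; split=> [p x y pp|p q x pp qp|p x pp|p r x pp|p a x pp].
  - exact: phiD.
  - have [->//|pq] := eqVneq p q.
    (* For distinct primes both composites vanish, their values being killed by [u] and by [v]. *)
    have zero u v y : prime u -> prime v -> u != v -> phi u (phi v y) = 0.
      move=> pu pv uv; apply: (@mulrn_coprime_eq0 _ _ u v).
      + by rewrite prime_coprime // dvdn_prime2.
      + exact: phip.
      by rewrite -phiMn // phip // phi0.
    by rewrite !zero // eq_sym.
  - exact: phip.
  - by have := phiL p pp r x 0; rewrite phi0 // !addr0.
  exact: phiA.
have DPO : is_DPderiv mul gam actO phi d.
  apply/(DPderiv_log_deriv gam AmodO derO).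
  move=> n a n0.
  have [->|n1] := eqVneq n 1%N; first by rewrite (log_deriv1 d DP AmodO).
  have {}n1 : (1 < n)%N by case: n n0 n1 => [|[]].
  have [En|Nn] := eqVneq n (pdiv n ^ logn (pdiv n) n)%N; last first.
    rewrite phin_not_prime_power // (log_deriv_eq0 DP AmodO derO) // => p pp.
    apply: contraNneq Nn => En.
    have e0 : (0 < logn p n)%N by case: (logn p n) En n1 => // ->.
    by move: En e0; case: (logn p n) => // e -> _; rewrite pdiv_pfactor // pfactorK.
  have pp := pdiv_prime n1; rewrite En phin_prime_power //.
  (* Induction on the exponent: [d (gam (p ^ e) a)] equals [delta (p ^ e) a] plus elements of
     [A Omega], which [phi p] kills, so [phi p] sends [delta (p ^ e) a] to [delta p (gam (p ^ e) a)
     = delta (p ^ e.+1) a]. *)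
  elim: (logn _ n) => [|e IH]; first by rewrite (log_deriv1 d DP AmodO).
  rewrite iterS IH -(log_deriv_prime_gam DP AmodO derO) // -[RHS](phid _ pp).
  have q0 : (0 < pdiv n ^ e)%N by rewrite expn_gt0 prime_gt0.
  rewrite -(dgam_pos gam d a q0) (dgamE gam actO) (sum_gam_act gam AmodO) //.
  rewrite phiD // (big_morph _ (phiD _ pp) (phi0 _ pp)) big1 ?addr0 // => i _.
  exact: phiA.
exists phi; split=> //.
- move=> phi' Umod' DP' p x pp; have [_ _ uniq] := phiP p pp.
  apply/esym/uniq; first exact: Umod_frobenius_hom Umod' pp.
  move=> a; rewrite -(phin_prime phi' pp).
  by move/(DPderiv_log_deriv gam AmodO derO): DP' => -> //; rewrite prime_gt0.
move=> M actM phiM s UmodM DPs.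
have [AmodM _] := UmodM; have [derM _] := DPs.
have [f [fhom fd funiq]] := univO M actM s AmodM derM.
exists f; split=> //; last first.
  by move=> g [ghom _] gd; apply: funiq.
split=> // p x pp.
have [h [_ _ huniq]] := log_deriv_frobenius_hom calg DP univ AmodM derM pp.
have [fL fA] := fhom.
have fD y z : f (y + z) = f y + f z by have := fL 1 y z; rewrite !scale1r.
have f0 : f 0 = 0 by apply: (@addrI _ (f 0)); rewrite -fD !addr0.
have [phiML phiMA phiMp] := Umod_frobenius_hom UmodM pp.
have fMn y n : f (y *+ n) = f y *+ n.
  by elim: n => [|n IH]; rewrite ?mulr0n // !mulrS fD IH.
have phiM0 : phiM p 0 = 0.
  by case: UmodM => _ [H _ _ _ _]; apply: (@addrI _ (phiM p 0)); rewrite -H // !addr0.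
(* Both [f] after [phi p] and [phiM p] after [f] are Frobenius homs taking [d a] to the logarithmic
   derivative of [s] in degree [p], hence they coincide. *)
rewrite -(huniq (fun x => f (phi p x))) ?(huniq (fun x => phiM p (f x))) //.
- by split=> [r y z|a y|y]; rewrite ?fL ?phiML ?fA ?phiMA ?phiMp.
- move=> a; rewrite -fd -(phin_prime phiM pp).
  by move/(DPderiv_log_deriv gam AmodM derM): DPs => -> //; rewrite prime_gt0.
- by split=> [r y z|a y|y]; rewrite ?phiL ?fL ?phiA // -?fMn ?phip.
by move=> a; rewrite phid // (Ahom_log_deriv _ _ _ fhom fd).
Qed.
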